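(* Let $n\ge 3$, let $(g_2,\dots,g_n)$ be a tower with cycle $C$, and let $u_n=g_{n-1}^{-1}g_n$. The cycle $C$ is dihedral if every $g_k$ $(2\le k\le n)$ is an involution, and cyclic otherwise. In the first case $\mathrm{Stab}(C)=\langle L_{u_n},L_{g_n}\rangle\cong D_n$ (dihedral of order $2n$); in the second $\mathrm{Stab}(C)=\langle L_{u_n}\rangle\cong C_n$ (cyclic of order $n$). The number of towers $(g_2,\dots,g_n)$ in which every $g_k$ is an involution is $$\prod_{k=2}^{n}2^{\lfloor (k-1)/2\rfloor}\bigl\lfloor (k-1)/2\bigr\rfloor!\;=\;2^{\lfloor (n-1)^2/4\rfloor}\prod_{k=2}^{n}\bigl\lfloor (k-1)/2\bigr\rfloor!.$$
   Context: Permutations in $S_n$ are multiplied as functions: $(\pi g)(i)=\pi(g(i))$. For $1\le k\le n$, $G_k=\mathrm{Sym}\{1,\dots,k\}$ is the subgroup of $S_n$ of permutations fixing each of $k+1,\dots,n$. A $k$-cycle on $\{1,\dots,k\}$ is an element of $G_k$ that is a single cycle of length $k$. A tower is a sequence $(g_2,\dots,g_n)$ with $g_k\in G_k\setminus G_{k-1}$ such that, setting $g_1:=\mathbf 1$, each $u_k:=g_{k-1}^{-1}g_k$ is a $k$-cycle on $\{1,\dots,k\}$ $(2\le k\le n)$. Words over the alphabet $\{g_2,\dots,g_n\}$: $M_1=\varepsilon$ and $M_k=(M_{k-1}\,g_k)^{k-1}M_{k-1}$ for $2\le k\le n$. Write $M_ng_n=w_1w_2\cdots w_{n!}$ and $p_m=w_1\cdots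 w_m\in S_n$ (product in $S_n$, $p_0=\mathbf 1$). The cycle of the tower is the Hamiltonian cycle $p_0,p_1,\dots,p_{n!-1},p_{n!}=p_0$ in $\mathrm{Cay}(S_n,\{g_2,\dots,g_n\})$; it is viewed as a set of undirected edges, $C=\{\{p_m,p_{m+1}\}:0\le m<n!\}$. For $g\in S_n$, $L_g$ is the left translation $\sigma\mapsto g\sigma$ of $S_n$; $L(S_n)=\{L_g:g\in S_n\}$. $\mathrm{Stab}(C)$ is the setwise stabilizer of the edge set $C$ inside $L(S_n)$. A Hamiltonian cycle $C$ in a Cayley graph on $S_n$ is called cyclic when $\mathrm{Stab}(C)\cong C_n$ (cyclic group of order $n$) and dihedral when $\mathrm{Stab}(C)\cong D_n$ (dihedral group of order $2n$). *)

(* Defs.v *)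
From mathcomp Require Import all_boot zmodp all_fingroup all_solvable.

Set Implicit Arguments.
Unset Strict Implicit.
Unset Printing Implicit Defensive.

Import GroupScope.

(* S_n is 'S_n = {perm 'I_n}, so the points 1, ..., n become 0, ..., n-1.
   MathComp composes permutations left to right, (s * t) x = t (s x); the
   product used here composes them as functions. *)
Definition fmul n (s t : 'S_n) : 'S_n := t * s.

Notation "s ∘ t" := (fmul s t) (at level 40, left associativity).

Lemma fmulE n (s t : 'S_n) (i : 'I_n) : (s ∘ t) i = s (t i).
Proof. exact: permM. Qed.

Lemma fmul_inj n (g : 'S_n) : injective (fmul g).
Proof. exact: mulIg. Qed.

Definition pts n k : {set 'I_n} := [set i : 'I_n | i < k].

Definition Gsym n k : {set 'S_n} := perm.Sym (pts n k).

Definition is_kcycle n k (u : 'S_n) : bool :=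
  (u \in Gsym n k) && (pts n k \in porbits u).

(* The tuple (g_2, ..., g_n) is stored as t : n.-1.-tuple 'S_n; gen t k is g_k,
   with g_1 = 1. *)
Definition gen n (t : n.-1.-tuple 'S_n) k : 'S_n := nth 1 (1 :: t) k.-1.

Definition step n (t : n.-1.-tuple 'S_n) k : 'S_n :=
  (gen t k.-1)^-1 ∘ gen t k.

Definition tower n (t : n.-1.-tuple 'S_n) : bool :=
  [forall k : 'I_n.+1, (2 <= k) ==>
     (gen t k \in Gsym n k :\: Gsym n k.-1) && is_kcycle k (step t k)].

Definition all_involutions n (t : n.-1.-tuple 'S_n) : bool :=
  all (fun g : 'S_n => #[g] == 2) t.

Definition alphabet n (t : n.-1.-tuple 'S_n) : {set 'S_n} := [set:: t].

(* M_k = (M_(k-1) g_k)^(k-1) M_(k-1); the junk value at k = 0 is the empty word,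
   which makes the recursion return the empty word at k = 1. *)
Fixpoint M n (t : n.-1.-tuple 'S_n) k : seq 'S_n :=
  if k is k'.+1 then
    flatten (nseq k' (rcons (M t k') (gen t k))) ++ M t k'
  else [::].

Definition word n (t : n.-1.-tuple 'S_n) : seq 'S_n := rcons (M t n) (gen t n).

Definition prefix_prod n (t : n.-1.-tuple 'S_n) m : 'S_n :=
  foldl (@fmul n) 1 (take m (word t)).

Definition tower_cycle n (t : n.-1.-tuple 'S_n) : {set {set 'S_n}} :=
  [set [set prefix_prod t m; prefix_prod t m.+1] | m : 'I_(n`!)].

Definition cayley n (S : {set 'S_n}) : rel 'S_n :=
  fun s t => (s^-1 ∘ t \in S) || (t^-1 ∘ s \in S).

Definition hamiltonian_cycle n (S : {set 'S_n}) (C : {set {set 'S_n}}) : Prop :=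
  exists c : seq 'S_n,
    [/\ ucycle (cayley S) c, forall s, s \in c
      & C = [set [set s; next c s] | s in c]].

Definition ltrans n (g : 'S_n) : {perm 'S_n} := perm (@fmul_inj n g).

Definition LS n : {set {perm 'S_n}} := [set ltrans g | g : 'S_n].

Lemma LS_group_set n : group_set (LS n).
Proof.
apply/group_setP; split=> [|_ _ /imsetP[g _ ->] /imsetP[h _ ->]].
  by apply/imsetP; exists 1 => //; apply/permP=> s; rewrite perm1 permE /fmul mulg1.
apply/imsetP; exists (h ∘ g) => //; apply/permP=> s.
by rewrite permM !permE /fmul mulgA.
Qed.

Canonical LS_group n := Group (LS_group_set n).

(* 'P^* is the action of {perm 'S_n} on subsets of 'S_n by direct image; this is
   the setwise stabilizer of C, as a set of edges, under that action. *)
Definition Stab n (C : {set {set 'S_n}}) : {group {perm 'S_n}} :=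
  'N_(LS n)(C | 'P^*)%G.

Definition cyclic_cycle n (S : {set 'S_n}) (C : {set {set 'S_n}}) : Prop :=
  hamiltonian_cycle S C /\ Stab C \isog Zp n.

(* In MathComp 'D_m is the dihedral group of order m. *)
Definition dihedral_cycle n (S : {set 'S_n}) (C : {set {set 'S_n}}) : Prop :=
  hamiltonian_cycle S C /\ Stab C \isog 'D_(2 * n).

(* Main.v *)
Require Import Defs.
From mathcomp Require Import all_boot zmodp all_fingroup all_solvable.
From mathcomp Require Import zify.
Import GroupScope.

(** Write products in the left-to-right order of the group law on permutations:
    then p_(m+1) = w_(m+1) * p_m, the translation L_g is right multiplication
    by g, and u_k = g_k * g_(k-1)^-1.

    The cycle.  Since u_k has order k, induction on k gives that the product of
    M_k is g_k^-1 ([wprod_M]), and then p_(q (k-1)! + r) = p_r * u_k ^ q for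
    q < k and r < (k-1)! ([vtx_block]).  The powers of the k-cycle u_k move the
    last of the first k points to k different places, so they represent the
    cosets of G_(k-1) in G_k; hence p enumerates G_k without repetition
    ([vtx_inj_small]), and for k = n the walk is a Hamiltonian cycle.

    The stabilizer.  Up to inversion, an edge and its translates carry the same
    generator p_(m+1) * p_m^-1.  The edges of the cycle whose generator lies
    outside G_(n-1) are those joining g_n^-1 u_n^q to u_n^q ([edge_long]), and {g_n^-1, 1} is one of them; so a translation in
    the stabilizer is L_g with g = u_n^q or g = g_n^-1 u_n^q ([Stab_bound]).
    All the L_(u_n^q) belong to it ([step_Stab]), and everything depends on
    whether L_(g_n) does.  If it does, it must reverse the cycle
    ([gen_Stab_reflect]); reversal carries the generator g_k to the inverse of
    a generator, and g_k^-1 lies in G_k but not in G_(k-1), so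
    g_k^-1 = g_k ([gen_Stab_involutions]).  Conversely, if all the g_k are
    involutions, reversing the palindrome M_n inverts its product, which shows
    that L_(g_n) reverses the cycle ([vtx_reflect]); the stabilizer is then
    generated by the involutions L_(g_n) and L_(g_(n-1)), hence dihedral.

    The count.  Given a = g_(k-1) with a^2 = 1, the involutions g_k = u_k * a
    correspond to the k-cycles u_k = u with u ^ a = u^-1.  On the points of such
    a cycle, a is the reflection of a k-gon fixing the vertex x0 (the last of
    the first k points), so the cycle read from x0 is
      x0, s, (the other fixed point of a, if k is even), reversed a(s),
    where s lists one point from each of the m transpositions of a, with m equal
    to (k-1)/2 rounded down ([traject_inverted]); every such s occurs
    ([symmetric_list_cycle]), and there are 2^m m! of them
    ([card_pair_transversals]).  Finally g_k is a reflection of the k-gon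
    through the midpoint of an edge, so that it moves all the k points, or all
    but one ([card_support_mul]): the next step can be counted in the same way. *)

Set Implicit Arguments.
Unset Strict Implicit.
Unset Printing Implicit Defensive.

(** * Symmetric groups on initial segments, and cycles of full length *)

Canonical Gsym_group n k := Eval hnf in [group of Gsym n k].

Lemma in_Gsym n k (s : 'S_n) :
  reflect (forall x : 'I_n, k <= x -> s x = x) (s \in Gsym n k).
Proof.
rewrite inE; apply: (iffP subsetP) => fix_s x.
  by move=> le_kx; apply/eqP/negbNE/negP => /fix_s; rewrite inE ltnNge le_kx.
by rewrite !inE; apply: contraR; rewrite -leqNgt => /fix_s ->.
Qed.

Lemma GsymS n k l : k <= l -> Gsym n k \subset Gsym n l.
Proof.
move=> le_kl; apply/subsetP=> s /in_Gsym fix_s; apply/in_Gsym=> x le_lx.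
exact/fix_s/(leq_trans le_kl).
Qed.

Lemma card_pts n k : k <= n -> #|pts n k| = k.
Proof.
move=> le_kn; rewrite -[RHS]card_ord.
have /card_imset <- : injective (widen_ord le_kn) by move=> i j [/val_inj].
apply: eq_card => x; rewrite inE; apply/idP/imsetP => [lt_xk | [y _ ->]] //=.
by exists (Ordinal lt_xk) => //; apply: val_inj.
Qed.

Section FullCycles.

Variables (n k : nat) (u : 'S_n).
Hypotheses (k_gt0 : 0 < k) (le_kn : k <= n) (kcyc_u : is_kcycle k u).

Lemma porbit_kcycle x : x \in pts n k -> porbit u x = pts n k.
Proof.
case/andP: kcyc_u => _ /imsetP[y _ ->] u_xy.
by apply/eqP; rewrite eq_porbit_mem.
Qed.

Lemma expg_kcycle : u ^+ k = 1.
Proof.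
case/andP: kcyc_u => /in_Gsym fix_u _; apply/permP=> x; rewrite permX perm1.
have [lt_xk | le_kx] := ltnP x k; last first.
  by rewrite iter_fix // fix_u.
by rewrite -[in LHS](card_pts le_kn) -(porbit_kcycle (x := x)) ?inE // iter_porbit.
Qed.

Lemma trajectP_kcycle x : x \in pts n k ->
  uniq (traject u x k) /\ traject u x k =i pts n k.
Proof.
move=> /porbit_kcycle ux; rewrite -{1 2}(card_pts le_kn) -ux.
by split; [exact: uniq_traject_porbit | move=> y; rewrite -porbit_traject].
Qed.

Lemma order_kcycle : #[u] = k.
Proof.
have lt0n : 0 < n by apply: leq_trans le_kn.
pose x := Ordinal lt0n.
have [|uniq_t _] := @trajectP_kcycle x; first by rewrite inE.
apply/eqP; rewrite eqn_dvd order_dvdn expg_kcycle eqxx /=.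
have := expg_order u; have := order_gt0 u; rewrite {2}(divn_eq #[u] k).
rewrite expgD mulnC expgM expg_kcycle expg1n mul1g => _ /permP/(_ x).
rewrite perm1 permX => ux; rewrite /dvdn; have lt_r := ltn_pmod #[u] k_gt0.
have := nth_uniq x _ _ uniq_t; move=> /(_ (#[u] %% k) 0); rewrite size_traject.
by rewrite !nth_traject //= ux eqxx lt_r k_gt0 => <-.
Qed.

(** A power of a full cycle is determined by the image of a single point: this
    is what separates cosets of point stabilizers later on. *)
Lemma expg_kcycle_eq x i j : x \in pts n k ->
  ((u ^+ i) x == (u ^+ j) x) = (i == j %[mod k]).
Proof.
move=> x_k; have [uniq_t _] := trajectP_kcycle x_k.
have mod_exp m : u ^+ m = u ^+ (m %% k) by rewrite -order_kcycle expg_mod_order.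
rewrite mod_exp [u ^+ j]mod_exp !permX.
by rewrite -!(@nth_traject _ u _ k) ?ltn_pmod // nth_uniq ?size_traject ?ltn_pmod.
Qed.

Lemma expg_kcycle_onto x y : x \in pts n k -> y \in pts n k ->
  exists2 i, i < k & y = (u ^+ i) x.
Proof.
move=> x_k; have [_ <-] := trajectP_kcycle x_k.
by case/trajectP=> i lt_ik ->; exists i; rewrite ?permX.
Qed.

End FullCycles.

Lemma set2_inj (T : finType) (a b c d : T) :
  [set a; b] = [set c; d] -> (a = c /\ b = d) \/ (a = d /\ b = c).
Proof.
move/setP=> eqE; move: (eqE a) (eqE b) (eqE c) (eqE d); rewrite !inE !eqxx ?orbT /=.
move=> /esym/orP[]/eqP<- /esym/orP[]/eqP->; rewrite ?eqxx ?orbT ?orbb; auto.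
- by move=> _ /eqP->; left.
- by move=> /eqP->; right.
Qed.

(** * Translations of the symmetric group *)

Section Translations.

Variable n : nat.

Lemma ltransE (g s : 'S_n) : ltrans g s = s * g.
Proof. by rewrite permE. Qed.

Lemma ltransM : {in [set: 'S_n] &, {morph @ltrans n : g h / g * h}}.
Proof. by move=> g h _ _; apply/permP=> s; rewrite permM !ltransE mulgA. Qed.

Canonical ltrans_morphism := Morphism ltransM.

Lemma injm_ltrans : 'injm (@ltrans n).
Proof.
apply/injmP=> g h _ _ /permP/(_ 1).
by rewrite !ltransE !mul1g.
Qed.

Lemma ltrans_LS (g : 'S_n) : ltrans g \in LS n.
Proof. exact: imset_f. Qed.

Lemma ltransX (g : 'S_n) q : ltrans (g ^+ q) = ltrans g ^+ q.
Proof. by rewrite (morphX ltrans_morphism) ?inE. Qed.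

Lemma ltransV (g : 'S_n) : ltrans g^-1 = (ltrans g)^-1.
Proof. by rewrite (morphV ltrans_morphism) ?inE. Qed.

Lemma order_ltrans (g : 'S_n) : #[ltrans g] = #[g].
Proof. by rewrite (order_injm injm_ltrans) ?inE. Qed.

(** As C is finite, a translation that maps C into itself preserves it. *)
Lemma mem_Stab (C : {set {set 'S_n}}) g :
  (ltrans g \in Stab C) = (C \subset [set E : {set 'S_n} | [set s * g | s in E] \in C]).
Proof.
rewrite inE ltrans_LS !inE /=; apply: eq_subset_r => E; rewrite !inE /setact.
by congr (_ \in C); apply: eq_imset => s; rewrite /= apermE ltransE.
Qed.

End Translations.

(** * Partial products of the words M_k *)

Definition wprod n (s : seq 'S_n) : 'S_n := foldl (@fmul n) 1 s.

Lemma wprod_cat n (s1 s2 : seq 'S_n) : wprod (s1 ++ s2) = wprod s2 * wprod s1.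
Proof.
rewrite /wprod foldl_cat; elim/last_ind: s2 => [|s2 g IHs] /=; first by rewrite mul1g.
by rewrite !foldl_rcons IHs /fmul mulgA.
Qed.

Lemma wprod_rcons n (s : seq 'S_n) g : wprod (rcons s g) = g * wprod s.
Proof. by rewrite -cats1 wprod_cat /wprod /= /fmul mulg1. Qed.

Lemma wprod_nseq n (s : seq 'S_n) q : wprod (flatten (nseq q s)) = wprod s ^+ q.
Proof. by elim: q => //= q IHq; rewrite wprod_cat IHq expgSr. Qed.

Lemma size_flatten_nseq (T : Type) (s : seq T) q :
  size (flatten (nseq q s)) = (q * size s)%N.
Proof. by rewrite size_flatten /shape map_nseq sumn_nseq mulnC. Qed.

Section Tower.

Variables (n : nat) (t : n.-1.-tuple 'S_n).

Lemma M_S k : M t k.+1 = flatten (nseq k (rcons (M t k) (gen t k.+1))) ++ M t k.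
Proof. by []. Qed.

Lemma size_M k : 0 < k -> (size (M t k)).+1 = k`!.
Proof.
elim: k => // -[//|k] IHk _; rewrite M_S size_cat size_flatten_nseq size_rcons.
by rewrite IHk // -addnS IHk // addnC -mulSn -factS.
Qed.

Lemma M_prefix k l : 0 < k -> k <= l -> prefix (M t k) (M t l).
Proof.
move=> k_gt0; elim: l => [|l IHl]; first by case: k k_gt0.
rewrite leq_eqVlt => /predU1P[-> | ]; first exact: prefix_refl.
rewrite ltnS => le_kl; apply: prefix_trans (IHl le_kl) _.
case: l {IHl} le_kl => [|l] le_kl; first by case: k k_gt0 le_kl.
by rewrite M_S /= -catA cat_rcons prefix_prefix.
Qed.

Lemma take_M k l m : 0 < k -> k <= l -> m < k`! ->
  take m (M t l) = take m (M t k).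
Proof.
move=> k_gt0 le_kl; rewrite -size_M // ltnS => le_m.
by case/prefixP: (M_prefix k_gt0 le_kl) => s ->; rewrite takel_cat.
Qed.

(** Division of a position by k!: the quotient counts the blocks M_k g_(k+1)
    completed before it, the remainder is the position inside a copy of M_k. *)
Lemma take_M_block k q r : 0 < k -> q <= k -> r < k`! ->
  take (q * k`! + r) (M t k.+1)
    = flatten (nseq q (rcons (M t k) (gen t k.+1))) ++ take r (M t k).
Proof.
move=> k_gt0 le_qk lt_r.
rewrite M_S; set b := rcons _ _.
have -> : nseq k b = nseq q b ++ nseq (k - q) b by rewrite -nseqD subnKC.
rewrite flatten_cat -catA.
set s := flatten (nseq q _); have sz : size s = (q * k`!)%N.
  by rewrite size_flatten_nseq size_rcons size_M.
rewrite take_cat sz ltnNge leq_addr /= addKn; congr (_ ++ _).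
case: (k - q) => //= j; rewrite -catA /b cat_rcons takel_cat //.
by rewrite -ltnS size_M.
Qed.

Hypothesis towt : tower t.

Lemma gen1 : gen t 1 = 1. Proof. by []. Qed.

Lemma towerP k : 1 < k -> k <= n ->
  [/\ gen t k \in Gsym n k, gen t k \notin Gsym n k.-1 & is_kcycle k (step t k)].
Proof.
move=> k_gt1 le_kn; have := forallP towt (Ordinal (le_kn : k < n.+1)).
by rewrite k_gt1 inE => /andP[/andP[-> ->] ->].
Qed.

Lemma stepE k : step t k = gen t k * (gen t k.-1)^-1.
Proof. by []. Qed.

Lemma gen_in k : 0 < k -> k <= n -> gen t k \in Gsym n k.
Proof.
case: k => [|[|k]] // _ => [_ | /towerP[]//]; exact: group1.
Qed.

(** Each block M_(k-1) g_k has product u_k, so M_k g_k has product u_k ^ k = 1. *)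
Lemma wprod_M k : 0 < k -> k <= n -> wprod (M t k) = (gen t k)^-1.
Proof.
elim: k => // -[|k] IHk _ le_kn; first by rewrite gen1 invg1.
have [_ _ kcyc] := towerP (isT : 1 < k.+2) le_kn.
rewrite M_S wprod_cat wprod_nseq wprod_rcons IHk ?(ltnW le_kn) //.
rewrite -stepE; have := expg_kcycle le_kn kcyc.
rewrite expgS => /(canRL (mulKg _)) ->.
by rewrite mulg1 stepE invMg invgK mulgA mulVg mul1g.
Qed.

Lemma wprod_block k q r : 0 < k -> k < n -> q <= k -> r < k`! ->
  wprod (take (q * k`! + r) (M t k.+1))
    = wprod (take r (M t k)) * step t k.+1 ^+ q.
Proof.
move=> k_gt0 lt_kn le_qk lt_r; rewrite take_M_block // wprod_cat wprod_nseq.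
by rewrite wprod_rcons wprod_M // ltnW.
Qed.

(** The vertices are indexed modulo n!, so that the closing edge needs no
    separate treatment. *)
Definition vtx m := wprod (take (m %% n`!) (M t n)).

Lemma wprod_word : wprod (word t) = 1.
Proof.
case: (posnP n) => [n0 | n_gt0]; last by rewrite wprod_rcons wprod_M // mulgV.
apply/permP=> -[i lt_i]; have: i < 0 by rewrite -n0. by [].
Qed.

Lemma size_word : 0 < n -> size (word t) = n`!.
Proof. by move=> n_gt0; rewrite size_rcons size_M. Qed.

Lemma prefix_prod_vtx m : 0 < n -> m <= n`! -> prefix_prod t m = vtx m.
Proof.
move=> n_gt0; rewrite leq_eqVlt /vtx => /predU1P[-> | lt_m].
  rewrite modnn take0 -[in RHS]/(wprod [::]) /prefix_prod -size_word // take_size.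
  exact: wprod_word.
rewrite modn_small // /prefix_prod /word -cats1 takel_cat //.
by rewrite -ltnS size_M.
Qed.

Lemma vtx_small k m : 0 < k -> k <= n -> m < k`! -> vtx m = wprod (take m (M t k)).
Proof.
move=> k_gt0 le_kn lt_m; have lt_mn : m < n`! by apply: leq_trans lt_m (leq_fact le_kn).
by rewrite /vtx modn_small // (take_M k_gt0).
Qed.

Lemma vtx_block k q r : 0 < k -> k < n -> q <= k -> r < k`! ->
  vtx (q * k`! + r) = vtx r * step t k.+1 ^+ q.
Proof.
move=> k_gt0 lt_kn le_qk lt_r.
have lt_m : q * k`! + r < k.+1`!.
  by rewrite factS mulSnr addnC -ltn_subRL; nia.
by rewrite !(@vtx_small k.+1) // ?wprod_block ?(@take_M k) //; nia.
Qed.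

Lemma vtx0 : vtx 0 = 1.
Proof. by rewrite /vtx mod0n take0. Qed.

Lemma step_in k : 1 < k -> k <= n -> step t k \in Gsym n k.
Proof. by move=> k_gt1 le_kn; case: (towerP k_gt1 le_kn) => _ _ /andP[]. Qed.

Lemma vtx_in k m : 0 < k -> k <= n -> m < k`! -> vtx m \in Gsym n k.
Proof.
elim: k m => // -[|k] IHk m _ le_kn.
  by rewrite ltnS leqn0 => /eqP->; rewrite vtx0 group1.
have k1_gt0 := fact_gt0 k.+1; rewrite factS -ltn_divLR // => lt_q.
have lt_r := ltn_pmod m k1_gt0.
rewrite (divn_eq m k.+1`!) vtx_block //; apply: groupM; last by rewrite groupX ?step_in.
exact: (subsetP (GsymS _ (leqnSn _))) (IHk _ isT (ltnW le_kn) lt_r).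
Qed.

(** By induction on k, the vertices numbered below k! are pairwise distinct:
    those in one block share a coset of G_(k-1), and different blocks lie in
    different cosets. *)
Lemma vtx_inj_small k m m' : 0 < k -> k <= n -> m < k`! -> m' < k`! ->
  vtx m = vtx m' -> m = m'.
Proof.
elim: k m m' => // -[|k] IHk m m' _ le_kn.
  by rewrite !ltnS !leqn0 => /eqP-> /eqP->.
have k1_gt0 := fact_gt0 k.+1.
rewrite factS -(ltn_divLR m) // -(ltn_divLR m') //.
have lt_r := ltn_pmod m k1_gt0; have lt_r' := ltn_pmod m' k1_gt0.
have [em em'] := (divn_eq m k.+1`!, divn_eq m' k.+1`!).
move: (m %/ _) (m' %/ _) (m %% _) (m' %% _) em em' lt_r lt_r'.
move=> q q' r r' -> -> lt_r lt_r'.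
move=> lt_q lt_q'; rewrite !vtx_block // => eq_v.
(* the last of the k+2 points is fixed by the smaller group, so its image
   depends on the coset only *)
have [_ _ kcyc] := towerP (isT : 1 < k.+2) le_kn; pose x := Ordinal le_kn.
have x_k : x \in pts n k.+2 by rewrite inE.
have fix_x s : s < k.+1`! -> vtx s x = x.
  by move=> lt_s; have /in_Gsym-> := vtx_in (isT : 0 < k.+1) (ltnW le_kn) lt_s.
have /eqP := congr1 (fun s : 'S_n => s x) eq_v.
rewrite !permM !fix_x // (expg_kcycle_eq _ le_kn kcyc _ _ x_k) //.
rewrite !modn_small // => /eqP eq_q; move: eq_v; rewrite eq_q => /mulIg eq_r.
by rewrite (IHk r r' isT (ltnW le_kn) lt_r lt_r' eq_r).
Qed.

Hypothesis n_gt0 : 0 < n.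

Lemma eq_vtx m m' : (vtx m == vtx m') = (m == m' %[mod n`!]).
Proof.
have vtx_mod l : vtx l = vtx (l %% n`!) by rewrite /vtx modn_mod.
apply/eqP/eqP => [|eq_m]; last by rewrite vtx_mod eq_m -vtx_mod.
rewrite vtx_mod [vtx m']vtx_mod; apply: (@vtx_inj_small n) => //.
all: by rewrite ltn_pmod ?fact_gt0.
Qed.

Lemma vtx_onto g : exists2 m, m < n`! & g = vtx m.
Proof.
pose f (m : 'I_n`!) := vtx m.
have inj_f : injective f.
  move=> i j /eqP; rewrite eq_vtx !modn_small // => /eqP; exact: val_inj.
have le_card : #|{perm 'I_n}| <= #|'I_n`!|.
  by rewrite card_Sn card_ord.
have /codomP[m ->] := inj_card_onto inj_f le_card g.
by exists m.
Qed.

Hypothesis n_gt1 : 1 < n.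
Let u := step t n.

(** Right multiplication by u_n turns the cycle by one block: the word read
    around the cycle is periodic with period (n-1)!. *)
Lemma vtx_rotate m : vtx (m + n.-1`!) = vtx m * u.
Proof.
have lt0n1 : 0 < n.-1 by rewrite -ltnS prednK.
have block q r : r < n.-1`! -> vtx (q * n.-1`! + r) = vtx r * u ^+ q.
  move=> lt_r.
  have -> : vtx (q * n.-1`! + r) = vtx ((q %% n) * n.-1`! + r).
    apply/eqP; rewrite eq_vtx {1}(divn_eq q n) mulnDl -mulnA.
    have -> : (n * n.-1`! = n`!)%N by rewrite -{1}(prednK n_gt0) -factS prednK.
    by rewrite -addnA modnMDl.
  have le_q : q %% n <= n.-1 by rewrite -ltnS prednK ?ltn_pmod.
  rewrite vtx_block ?ltn_predL // prednK // -/u; congr (_ * _).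
  have [_ _ kcyc] := towerP n_gt1 (leqnn n).
  by rewrite -[in RHS](expg_mod_order u) (order_kcycle n_gt0 (leqnn n) kcyc).
rewrite {1}(divn_eq m n.-1`!) addnAC -mulSnr block ?ltn_pmod ?fact_gt0 //.
by rewrite [in RHS](divn_eq m n.-1`!) block ?ltn_pmod ?fact_gt0 // expgSr mulgA.
Qed.

Lemma vtx_rotateX m q : vtx (m + q * n.-1`!) = vtx m * u ^+ q.
Proof.
elim: q => [|q IHq]; first by rewrite mul0n addn0 expg0 mulg1.
by rewrite mulSnr addnA vtx_rotate IHq -mulgA -expgSr.
Qed.

Lemma vtx_last k : 0 < k -> k <= n -> vtx k`!.-1 = (gen t k)^-1.
Proof.
move=> k_gt0 le_kn; rewrite (vtx_small k_gt0 le_kn) ?prednK ?fact_gt0 //.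
by rewrite -(wprod_M k_gt0 le_kn) -(size_M k_gt0) take_size.
Qed.

Lemma alphabetP g :
  reflect (exists k, [/\ 1 < k, k <= n & g = gen t k]) (g \in alphabet t).
Proof.
rewrite inE; apply: (iffP (nthP 1)) => [[i lt_i <-] | [[|[|k]] [// _ le_kn ->]]].
  rewrite size_tuple in lt_i; exists i.+2; split=> //.
  by rewrite -(prednK n_gt0) ltnS.
by exists k => //; rewrite size_tuple -ltnS prednK.
Qed.

Lemma mem_M k g : k <= n -> g \in M t k -> g \in alphabet t.
Proof.
elim: k => // k IHk lt_kn; have {}IHk := IHk (ltnW lt_kn).
rewrite M_S mem_cat => /orP[|//] /flattenP[s].
case: k IHk lt_kn => // k IHk lt_kn; rewrite mem_nseq => /andP[_ /eqP->].
rewrite mem_rcons inE => /predU1P[->|//]; apply/alphabetP.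
by exists k.+2.
Qed.

Lemma vtx_S m : vtx m.+1 * (vtx m)^-1 \in alphabet t.
Proof.
have lt_r := ltn_pmod m (fact_gt0 n); set r := m %% n`! in lt_r.
have -> : vtx m = vtx r by apply/eqP; rewrite eq_vtx modn_mod.
have -> : vtx m.+1 = vtx r.+1.
  by apply/eqP; rewrite eq_vtx -[m.+1]addn1 -modnDml addn1.
rewrite -!prefix_prod_vtx ?(ltnW lt_r) // /prefix_prod.
have lt_rs : r < size (word t) by rewrite size_word.
rewrite (take_nth 1) // foldl_rcons /fmul mulgK.
have := mem_nth 1 lt_rs; rewrite mem_rcons inE => /predU1P[-> | ].
  by apply/alphabetP; exists n.
exact: mem_M.
Qed.

(** * The Hamiltonian cycle *)

Definition edge m : {set 'S_n} := [set vtx m; vtx m.+1].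

Lemma mem_tower_cycle E :
  reflect (exists m, E = edge m) (E \in tower_cycle t).
Proof.
apply: (iffP imsetP) => [[m _ ->] | [m ->]].
  by exists m; rewrite !prefix_prod_vtx // ltnW.
have lt_r := ltn_pmod m (fact_gt0 n); exists (Ordinal lt_r) => //=.
rewrite !prefix_prod_vtx ?(ltnW lt_r) //; congr [set _; _]; apply/eqP.
  by rewrite eq_vtx modn_mod.
by rewrite eq_vtx -[m.+1]addn1 -modnDml addn1.
Qed.

Lemma next_vtx m : m < n`! -> next (mkseq vtx n`!) (vtx m) = vtx m.+1.
Proof.
move=> lt_m; have uniq_v : uniq (mkseq vtx n`!).
  apply/(mkseq_uniqP _ n`!) => i j; rewrite !inE => lt_i lt_j.
  exact: (vtx_inj_small n_gt0 (leqnn n)).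
have v_m : vtx m \in mkseq vtx n`! by apply/mapP; exists m; rewrite ?mem_iota.
have idx : index (vtx m) (mkseq vtx n`!) = m.
  by rewrite -{1}(nth_mkseq 1 vtx lt_m) index_uniq ?size_mkseq.
rewrite next_nth v_m idx; have N_gt0 := fact_gt0 n.
have := nth_mkseq (vtx 0) vtx; have := size_mkseq vtx n`!.
rewrite /mkseq; case EN: n`! N_gt0 lt_m => [//|N] _ lt_m /= [sz] nthv.
move: lt_m; rewrite ltnS leq_eqVlt => /predU1P[-> | lt_m]; last first.
  exact: (nthv N.+1 m.+1).
rewrite nth_default ?size_map ?size_iota //; apply/eqP.
by rewrite eq_vtx EN mod0n modnn.
Qed.

Lemma tower_hamiltonian : hamiltonian_cycle (alphabet t) (tower_cycle t).
Proof.
have uniq_v : uniq (mkseq vtx n`!).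
  apply/(mkseq_uniqP _ n`!) => i j; rewrite !inE => lt_i lt_j.
  exact: (vtx_inj_small n_gt0 (leqnn n)).
exists (mkseq vtx n`!); split.
- rewrite /ucycle uniq_v andbT; apply: cycle_from_next => // s /mapP[m].
  rewrite mem_iota => /andP[_ lt_m] ->; rewrite next_vtx // /cayley.
  by rewrite /fmul vtx_S.
- by move=> s; have [m lt_m ->] := vtx_onto s; apply/mapP; exists m; rewrite ?mem_iota.
apply/setP=> E; apply/imsetP/imsetP => [[m _ ->] | [s /mapP[m]]].
  exists (vtx m); first by apply/mapP; exists (m : nat); rewrite ?mem_iota /=.
  by rewrite next_vtx // !prefix_prod_vtx // ltnW.
rewrite mem_iota => /andP[_ lt_m] -> ->; exists (Ordinal lt_m) => //=.
by rewrite next_vtx // !prefix_prod_vtx // ltnW.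
Qed.

(** The only edges leaving a coset of the subgroup on the first n-1 points are
    those between consecutive blocks; inside a block the generator is one of
    the g_k with k < n. *)
Lemma edge_long m : vtx m.+1 * (vtx m)^-1 \notin Gsym n n.-1 ->
  exists q, vtx m = (gen t n)^-1 * u ^+ q /\ vtx m.+1 = u ^+ q.
Proof.
have F_gt0 := fact_gt0 n.-1; have n1_gt0 : 0 < n.-1 by rewrite -ltnS prednK.
have le_n1 : n.-1 <= n by apply: leq_pred.
have lt_r := ltn_pmod m F_gt0; rewrite {1 2}(divn_eq m n.-1`!).
rewrite -addnS !(addnC (_ * _)%N) !vtx_rotateX invMg mulgA mulgK.
have [lt_r1 | le_r1] := ltnP (m %% n.-1`!).+1 n.-1`!.
  by rewrite groupMl ?groupV ?vtx_in.
have er : m %% n.-1`! = n.-1`!.-1 by apply/eqP; rewrite -eqSS prednK // eqn_leq lt_r.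
move=> _; exists (m %/ n.-1`!).+1; rewrite {1 3}(divn_eq m n.-1`!) er.
rewrite -addnS prednK // -mulSnr -[(_.+1 * _)%N]add0n vtx_rotateX vtx0 mul1g.
split=> //; rewrite addnC vtx_rotateX vtx_last // expgS /u stepE.
by rewrite -!mulgA mulKg.
Qed.

(** * The stabilizer of the cycle *)

Lemma mem_Stab_vtx g :
  reflect (forall m, exists m', [set vtx m * g; vtx m.+1 * g] = edge m')
          (ltrans g \in Stab (tower_cycle t)).
Proof.
rewrite mem_Stab; apply: (iffP subsetP) => [stab m | stab E].
  have /stab : edge m \in tower_cycle t by apply/mem_tower_cycle; exists m.
  by rewrite inE imsetU1 imset_set1 => /mem_tower_cycle.
case/mem_tower_cycle=> m ->; rewrite inE imsetU1 imset_set1.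
exact/mem_tower_cycle/stab.
Qed.

Lemma step_Stab : ltrans u \in Stab (tower_cycle t).
Proof.
by apply/mem_Stab_vtx=> m; exists (m + n.-1`!); rewrite /edge -addSn !vtx_rotate.
Qed.

Lemma gen_nsub k : 1 < k -> k <= n -> gen t k \notin Gsym n k.-1.
Proof. by move=> k_gt1 le_kn; case: (towerP k_gt1 le_kn). Qed.

(** The translate of the edge {p_(n!-1), 1} carries g_n or its inverse as
    generator, so it is again one of the edges between blocks; the image of 1
    is one of its two ends. *)
Lemma Stab_bound h : h \in Stab (tower_cycle t) -> exists q,
  h = ltrans u ^+ q \/ h = ltrans (gen t n)^-1 * ltrans u ^+ q.
Proof.
move=> Sh; have /imsetP[g _ h_g] : h \in LS n by case/setIP: Sh.
move: Sh; rewrite {}h_g => /mem_Stab_vtx/(_ n`!.-1)[m].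
have N_gt0 := fact_gt0 n; rewrite vtx_last ?prednK //.
have -> : vtx n`! = 1 by rewrite -vtx0; apply/eqP; rewrite eq_vtx modnn mod0n.
rewrite mul1g => /set2_inj[] [eq1 eq2].
  have [|q [_ e]] := @edge_long m; last by exists q; left; rewrite eq2 e ltransX.
  by rewrite -eq1 -eq2 invMg invgK mulKVg gen_nsub.
have [|q [e _]] := @edge_long m.
  by rewrite -eq1 -eq2 mulgK groupV gen_nsub.
by exists q; right; rewrite eq2 e -ltransX ltransM ?inE.
Qed.

(** The layers G_k minus G_(k-1) are disjoint and contain one generator each. *)
Lemma gen_inj j k : 1 < j -> j <= n -> 1 < k -> k <= n ->
  gen t j \in Gsym n k -> gen t j \notin Gsym n k.-1 -> j = k.
Proof.
move=> j_gt1 le_jn k_gt1 le_kn jk jk1; have [j_gt0 k_gt0] := (ltnW j_gt1, ltnW k_gt1).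
apply/eqP; rewrite eqn_leq; apply/andP; split.
  apply: contraR (gen_nsub j_gt1 le_jn); rewrite -ltnNge => lt_kj.
  by rewrite (subsetP (GsymS _ _)  _ jk) // -ltnS prednK.
apply: contraR jk1; rewrite -ltnNge => lt_jk.
by rewrite (subsetP (GsymS _ _) _ (gen_in j_gt0 le_jn)) // -ltnS prednK.
Qed.

(** The inverse of g_k lies in the same layer as g_k, so it is not one of the
    other generators. *)
Lemma genV_involution k : 1 < k -> k <= n -> (gen t k)^-1 \in alphabet t ->
  #[gen t k] = 2.
Proof.
move=> k_gt1 le_kn /alphabetP[j [j_gt1 le_jn eq_j]].
have jk : j = k.
  by apply: gen_inj; rewrite -?eq_j ?groupV ?gen_nsub // gen_in // ltnW.
apply/eqP; rewrite (nt_prime_order (p := 2)) //.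
  by rewrite expgS expg1 -[in X in X * _](invgK (gen t k)) eq_j jk mulVg.
by apply: contraNneq (gen_nsub k_gt1 le_kn) => ->; rewrite group1.
Qed.

Lemma neighbour a x m : [set vtx a; x] = edge m ->
  x = vtx a.+1 \/ x = vtx (a + n`!.-1).
Proof.
have N_gt0 := fact_gt0 n.
case/set2_inj=> [] [/eqP]; rewrite eq_vtx => /eqP eq_m ->; [left | right]; apply/eqP.
  by rewrite eq_vtx -[m.+1]addn1 -[a.+1]addn1 -modnDml -eq_m modnDml.
rewrite eq_vtx -modnDml eq_m modnDml addSnnS prednK //.
by rewrite modnDr.
Qed.

Hypothesis n_gt2 : 2 < n.

(** L_(g_n) sends p_(n!-1) = g_n^-1 to p_0.  The image g_n of p_0 is then a
    neighbour of p_0; it is not p_1, which lies in G_(n-1), so it is p_(n!-1).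
    From two consecutive images the next one is forced, and the cycle is
    reversed.  Modulo n!, the index (n!-1) * i stands for -i. *)
Lemma gen_Stab_reflect : ltrans (gen t n) \in Stab (tower_cycle t) ->
  forall i, vtx (n`!.-1 + i) * gen t n = vtx (n`!.-1 * i).
Proof.
set g := gen t n => /mem_Stab_vtx stab.
have N_gt0 := fact_gt0 n.
have vN m : vtx (n`! + m) = vtx m by apply/eqP; rewrite eq_vtx modnDl.
have N_gt2 : 2 < n`! by apply: leq_trans n_gt2 (fact_geq n).
have A0 : vtx (n`!.-1 + 0) * g = vtx (n`!.-1 * 0).
  by rewrite addn0 muln0 vtx0 vtx_last // mulVg.
have vtx1_neq : vtx 1 != g.
  apply: contraNneq (gen_nsub n_gt1 (leqnn n)) => eq_g; rewrite -/g -eq_g.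
  have n1_gt1 : 1 < n.-1 by rewrite -ltnS prednK.
  by rewrite vtx_in ?leq_pred ?(ltnW n1_gt1) // (leq_trans n1_gt1) ?fact_geq.
have A1 : vtx (n`!.-1 + 1) * g = vtx (n`!.-1 * 1).
  have [m] := stab n`!.-1; rewrite addn1 muln1 prednK // -[n`!]addn0 vN vtx0 mul1g.
  rewrite addn0 vtx_last // mulVg -vtx0 => /neighbour[eq_g | ->].
    by rewrite eq_g eqxx in vtx1_neq.
  by rewrite add0n vtx_last.
suffices AA i : vtx (n`!.-1 + i) * g = vtx (n`!.-1 * i) /\
    vtx (n`!.-1 + i.+1) * g = vtx (n`!.-1 * i.+1) by move=> i; case: (AA i).
elim: i => // i [Ai Ai1]; split=> //.
have [m] := stab (n`!.-1 + i.+1); rewrite Ai1 -addnS => /neighbour[eq1 | ->].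
  (* the translation would identify the two neighbours of a vertex *)
  have : vtx (n`!.-1 + i.+2) * g = vtx (n`!.-1 + i) * g.
    by rewrite eq1 Ai -[RHS]vN mulnS -addSn prednK.
  move=> /mulIg/eqP; rewrite eq_vtx -addn2 addnA -[X in _ == X %[mod _]]addn0.
  by rewrite eqn_modDl mod0n modn_small.
by congr vtx; rewrite [in RHS]mulnS addnC.
Qed.

(** The edge leaving p_((k-1)!-1) carries g_k; the reversal turns it into an edge
    that carries g_k^-1 in the direction of the walk. *)
Lemma gen_Stab_involutions :
  ltrans (gen t n) \in Stab (tower_cycle t) -> all_involutions t.
Proof.
move/gen_Stab_reflect=> refl; have N_gt0 := fact_gt0 n.
apply/allP=> g t_g; have /alphabetP[k [k_gt1 le_kn ->]] : g \in alphabet t by rewrite inE.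
have [k1_gt0 le_k1n] : 0 < k.-1 /\ k.-1 <= n by split; lia.
apply/eqP/genV_involution => //.
have gk : gen t k = vtx k.-1`! * (vtx k.-1`!.-1)^-1.
  have := @vtx_block k.-1 1 0; rewrite !prednK ?(ltnW k_gt1) //.
  rewrite mul1n addn0 vtx0 mul1g expg1 => ->; rewrite ?fact_gt0 //.
  by rewrite vtx_last // invgK stepE mulgKV.
have vN m : vtx (n`! + m) = vtx m by apply/eqP; rewrite eq_vtx modnDl.
set i := k.-1`!; have i_gt0 : 0 < i := fact_gt0 _.
have [r1 r2] := (refl i, refl i.+1).
have e1 : vtx (n`!.-1 + i) = vtx i.-1.
  by rewrite -[RHS]vN; congr vtx; lia.
have e2 : vtx (n`!.-1 + i.+1) = vtx i.
  by rewrite -[RHS]vN; congr vtx; lia.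
rewrite e1 in r1; rewrite e2 in r2.
have -> : (gen t k)^-1 = vtx (n`!.-1 * i) * (vtx (n`!.-1 * i.+1))^-1.
  by rewrite -r1 -r2 gk !invMg !mulgA mulgK invgK.
have -> : vtx (n`!.-1 * i) = vtx (n`!.-1 * i.+1).+1.
  by rewrite -[LHS]vN mulnS -addSn prednK.
exact: vtx_S.
Qed.

(** * Towers of involutions *)

Lemma rev_M k : rev (M t k) = M t k.
Proof.
elim: k => // k IHk; rewrite M_S rev_cat IHk rev_flatten map_nseq rev_rcons IHk rev_nseq.
move: (M t k) (gen t k.+1) {IHk} => s g.
by elim: k => [|k IHk] /=; rewrite ?cats0 // -catA -IHk cat_rcons.
Qed.

Lemma all_involutionsP :
  reflect (forall k, 1 < k -> k <= n -> #[gen t k] = 2) (all_involutions t).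
Proof.
apply: (iffP allP) => inv => [k k_gt1 le_kn | g t_g].
  apply/eqP/inv; have : gen t k \in alphabet t by apply/alphabetP; exists k.
  by rewrite inE.
have /alphabetP[k [k_gt1 le_kn ->]] : g \in alphabet t by rewrite inE.
by rewrite inv.
Qed.

Lemma wprod_rev (s : seq 'S_n) : (forall g, g \in s -> #[g] = 2) ->
  wprod (rev s) = (wprod s)^-1.
Proof.
elim: s => [|g s IHs] inv; first by rewrite /wprod /= invg1.
rewrite rev_cons wprod_rcons IHs => [|h s_h]; last by rewrite inv // inE s_h orbT.
rewrite -cat1s wprod_cat invMg /wprod /= /fmul mulg1; congr (_ * _).
by apply/eqP; rewrite eq_sym eq_invg_mul -{1}[g]expg1 -expgSr -order_dvdn inv ?inE ?eqxx.
Qed.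

Section Involutions.

Hypothesis invt : all_involutions t.

Lemma order_gen k : 1 < k -> k <= n -> #[gen t k] = 2.
Proof. exact/all_involutionsP. Qed.

(** Split the palindrome M_n after m letters.  Reversing the second part gives
    the word of length n!-1-m at its start, and inverts its product, because
    the letters are involutions; the product of the two parts is g_n. *)
Lemma vtx_reflect m : vtx m * gen t n = vtx (n`!.-1 * m.+1).
Proof.
have N_gt0 := fact_gt0 n.
have lt_r := ltn_pmod m N_gt0; set r := m %% n`! in lt_r *.
have -> : vtx m = vtx r by apply/eqP; rewrite eq_vtx modn_mod.
have -> : vtx (n`!.-1 * m.+1) = vtx (n`!.-1 - r).
  have -> : n`!.-1 - r = (n`!.-1 * r.+1) %% n`!.
    have -> : (n`!.-1 * r.+1 = r * n`! + (n`!.-1 - r))%N by nia.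
    by rewrite modnMDl modn_small //; lia.
  apply/eqP; rewrite eq_vtx modn_mod -(modnMmr _ r.+1) -(modnMmr _ m.+1).
  by rewrite -[m.+1]addn1 -[r.+1]addn1 -(modnDml m).
have szM := size_M n_gt0.
rewrite !(@vtx_small n) //; last by lia.
have -> : n`!.-1 - r = size (M t n) - r by rewrite -szM.
have := rev_M n; move: (M t n) (@mem_M n) szM (wprod_M n_gt0 (leqnn n)).
move=> s mem_s szs wps revs; rewrite -{3}revs take_rev subKn; last by lia.
rewrite wprod_rev => [|g s_g]; last first.
  have /alphabetP[k [k_gt1 le_kn ->]] := mem_s g (leqnn n) (mem_drop s_g).
  exact: order_gen.
have := wps; rewrite -{1}(cat_take_drop r s) wprod_cat => /(canRL (mulgK _)) ->.
by rewrite invMg !invgK.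
Qed.

Lemma gen_Stab : ltrans (gen t n) \in Stab (tower_cycle t).
Proof.
apply/mem_Stab_vtx=> m; exists (n`!.-1 * m.+2)%N; rewrite /edge !vtx_reflect setUC.
have N_gt0 := fact_gt0 n.
congr [set _; _]; apply/eqP; rewrite eq_vtx; apply/eqP.
by rewrite [in RHS]mulnS -addSn prednK // modnDl.
Qed.

Lemma Stab_dihedral_eq :
  Stab (tower_cycle t) = <<[set ltrans u; ltrans (gen t n)]>> :> {set {perm 'S_n}}.
Proof.
apply/eqP; rewrite eqEsubset gen_subG subUset !sub1set step_Stab gen_Stab !andbT.
apply/subsetP=> h /Stab_bound[q [] ->].
  by rewrite groupX // mem_gen // !inE eqxx.
by rewrite ltransV groupM ?groupV ?groupX // mem_gen // !inE eqxx ?orbT.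
Qed.

Lemma order_step : #[u] = n.
Proof. by have [_ _ /(order_kcycle n_gt0 (leqnn n))] := towerP n_gt1 (leqnn n). Qed.

Lemma step_gen_prev : u^-1 * gen t n = gen t n.-1.
Proof. by rewrite /u stepE invMg invgK mulgKV. Qed.

Lemma genK k : 1 < k -> k <= n -> (gen t k)^-1 = gen t k.
Proof.
move=> k_gt1 le_kn; apply/eqP; rewrite eq_invg_mul -{1}[gen t k]expg1 -expgSr.
by rewrite -order_dvdn order_gen.
Qed.

(** Both u_n^-1 and the conjugate of u_n by g_n are equal to g_(n-1) g_n. *)
Lemma step_conj : u ^ gen t n = u^-1.
Proof.
have le_n1 : n.-1 <= n by apply: leq_pred.
have n1_gt1 : 1 < n.-1 by rewrite -ltnS prednK.
by rewrite /conjg /u stepE !mulgA mulVg mul1g invMg invgK !genK.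
Qed.

(** L_(g_n) inverts L_(u_n), so it normalizes the cyclic group generated by
    L_(u_n); it does not lie in it, since a power of L_(u_n) commutes with
    L_(u_n), which is not its own inverse, having order n > 2. *)
Lemma card_Stab_dihedral : #|Stab (tower_cycle t)| = (2 * n)%N.
Proof.
rewrite Stab_dihedral_eq; set lu := ltrans u; set lg := ltrans _.
have conj_lu : lu ^ lg = lu^-1.
  by rewrite /conjg /lu /lg -!ltransV -!ltransM ?inE // -step_conj /conjg.
have ord_lu : #[lu] = n by rewrite order_ltrans order_step.
have ord_lg : #[lg] = 2 by rewrite order_ltrans order_gen.
have norm_lg : <[lg]> \subset 'N(<[lu]>).
  by rewrite cycle_subG; apply/normP; rewrite -cycleJ conj_lu cycleV.
have -> : <<[set lu; lg]>> = <[lu]> <*> <[lg]> by rewrite joing_idl joing_idr.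
rewrite norm_joinEr // TI_cardMg; first by rewrite -!orderE ord_lu ord_lg mulnC.
rewrite setIC; apply: prime_TIg; first by rewrite -orderE ord_lg.
rewrite cycle_subG; apply: contraL n_gt2 => lu_lg; rewrite -leqNgt.
apply: dvdn_leq => //; rewrite -ord_lu order_dvdn expgS expg1.
have comm : commute lu lg := centsP (cycle_abelian lu) _ (cycle_id lu) _ lu_lg.
by move/eqP: conj_lu; rewrite conjgE comm mulKg eq_sym eq_invg_mul.
Qed.

(** A group generated by two distinct involutions is dihedral; L_(g_n) and
    L_(g_(n-1)) generate because u_n = g_n * g_(n-1)^-1.  They are distinct since g_n is not in G_(n-1), and g_(n-1) is an
    involution because n > 2. *)
Lemma Stab_dihedral_isog : Stab (tower_cycle t) \isog 'D_(2 * n).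
Proof.
have le_n1 : n.-1 <= n by apply: leq_pred.
have n1_gt1 : 1 < n.-1 by rewrite -ltnS prednK.
rewrite -card_Stab_dihedral; set lg := ltrans (gen t n).
pose lg' := ltrans (gen t n.-1).
suffices -> : Stab (tower_cycle t) = <<[set lg; lg']>>%G.
  apply: involutions_gen_dihedral; rewrite ?order_ltrans ?order_gen //.
  rewrite (inj_in_eq (injmP (injm_ltrans n))) ?inE //.
  by apply: contraNneq (gen_nsub n_gt1 (leqnn n)) => ->; rewrite gen_in // ltnW.
have lg'E : lg' = (ltrans u)^-1 * lg.
  by rewrite /lg' -step_gen_prev ltransM ?inE // ltransV.
apply/val_inj; rewrite /= Stab_dihedral_eq -/lg; apply/eqP.
rewrite eqEsubset !gen_subG !subUset !sub1set lg'E.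
have [g1 g2] : lg \in <<[set lg; lg']>> /\ lg' \in <<[set lg; lg']>>.
  by split; rewrite mem_gen // !inE eqxx ?orbT.
have [g3 g4] : lg \in <<[set ltrans u; lg]>> /\ ltrans u \in <<[set ltrans u; lg]>>.
  by split; rewrite mem_gen // !inE eqxx ?orbT.
rewrite g3 (groupM (groupVr g4) g3) -lg'E g1 !andbT.
have -> : ltrans u = lg * lg'^-1 by rewrite lg'E invMg invgK mulKVg.
exact: groupM g1 (groupVr g2).
Qed.

Lemma tower_dihedral :
  dihedral_cycle (alphabet t) (tower_cycle t) /\
  Stab (tower_cycle t) =
    <<[set ltrans (step t n); ltrans (gen t n)]>> :> {set {perm 'S_n}}.
Proof.
by split; [split; [exact: tower_hamiltonian | exact: Stab_dihedral_isog]
          | exact: Stab_dihedral_eq].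
Qed.

End Involutions.

Lemma tower_cyclic : ~~ all_involutions t ->
  cyclic_cycle (alphabet t) (tower_cycle t) /\
  Stab (tower_cycle t) = <[ltrans (step t n)]> :> {set {perm 'S_n}}.
Proof.
move=> ninv; have eqS : Stab (tower_cycle t) = <[ltrans (step t n)]> :> {set {perm 'S_n}}.
  apply/eqP; rewrite eqEsubset cycle_subG step_Stab andbT.
  apply/subsetP=> h Sh; have [q [-> | h_g]] := Stab_bound Sh; first exact: mem_cycle.
  case/negP: ninv; apply: gen_Stab_involutions.
  by rewrite h_g groupMr ?groupX ?step_Stab // ltransV groupV in Sh.
split=> //; split; first exact: tower_hamiltonian.
rewrite [X in X \isog _]eqS isog_sym.
have ord_u : #[ltrans (step t n)] = n.
  by rewrite order_ltrans; have [_ _ /(order_kcycle n_gt0 (leqnn n))] := towerP n_gt1 (leqnn n).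
by have := Zp_isog (ltrans (step t n)); rewrite ord_u.
Qed.

End Tower.

(** * Counting lists that meet each pair of an involution once *)

Lemma card_tuple_cons (T : finType) m (P : pred (m.+1.-tuple T)) :
  #|[set s | P s]| = (\sum_x #|[set s : m.-tuple T | P [tuple of x :: s]]|)%N.
Proof.
rewrite -sum1dep_card (partition_big (@thead _ _) predT) //=.
apply: eq_bigr => x _; rewrite -sum1dep_card.
rewrite (reindex (fun s : m.-tuple T => [tuple of x :: s])) /=; last first.
  exists (fun s : m.+1.-tuple T => [tuple of behead s]) => [s _ | s /andP[_ /eqP <-]].
    exact: val_inj.
  by rewrite -tuple_eta.
by apply: eq_bigl => s; rewrite theadE eqxx andbT.
Qed.

(** The first entry can be any of the 2m points; it excludes itself and its
    partner from the rest of the list. *)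
Lemma card_pair_transversals (T : finType) (a : T -> T) m (A : {set T}) :
    involutive a -> {in A, forall x, (a x \in A) && (a x != x)} ->
    #|A| = m.*2 ->
  #|[set s : m.-tuple T | all (mem A) s && uniq (s ++ map a s)]| = (2 ^ m * m`!)%N.
Proof.
move=> aK; elim: m A => [|m IHm] A stA cardA.
  by rewrite (@eq_card1 _ [tuple]) // => s; rewrite [s]tuple0 !inE.
rewrite card_tuple_cons (bigID (mem A)) /= [X in (_ + X)%N]big1 ?addn0; last first.
  by move=> x /negPf nAx; apply: eq_card0 => s; rewrite !inE nAx.
rewrite (eq_bigr (fun=> 2 ^ m * m`!)%N) => [|x Ax].
  by rewrite sum_nat_const cardA expnS factS -muln2; lia.
have /andP[Aax neq_ax] := stA x Ax.
pose A' := A :\ x :\ a x.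
have cardA' : #|A'| = m.*2.
  have := cardsD1 x A; have := cardsD1 (a x) (A :\ x).
  by rewrite -/A' !inE Ax Aax neq_ax cardA; lia.
rewrite -(IHm A' _ cardA') => [|y]; last first.
  rewrite !inE => /and3P[y_ax y_x Ay]; have /andP[-> ->] := stA y Ay.
  by rewrite (inj_eq (can_inj aK)) y_x !andbT -(inj_eq (can_inj aK)) aK.
apply: eq_card => s; rewrite !in_set Ax /=.
rewrite (uniq_catCA s [:: a x]) /=.
have mem_as y : (y \in map a s) = (a y \in s).
  by rewrite -{1}[y]aK (mem_map (can_inj aK)).
rewrite !mem_cat inE (eq_sym x) (negPf neq_ax) !mem_as aK.
have -> (l : seq T) : all (mem A') l = [&& all (mem A) l, x \notin l & a x \notin l].
  elim: l => //= y l ->; rewrite !inE (eq_sym x) (eq_sym (a x)).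
  by case: (y == x); case: (y == a x); case: (y \in A) => //=; rewrite ?andbF.
by case: (all _ _) => //=; case: (x \in s); case: (a x \in s).
Qed.

(** * Full cycles inverted by an involution *)

Section InvertedCycles.

Variables (n k : nat) (x0 : 'I_n) (a : 'S_n).
Hypotheses (k_gt1 : 1 < k) (le_kn : k <= n) (x0k : x0.+1 = k).
Hypotheses (a_in : a \in Gsym n k.-1) (a2 : a * a = 1).

Definition inverted_cycles : {set 'S_n} := [set u | is_kcycle k u & u ^ a == u^-1].

Let k_gt0 : 0 < k. Proof. exact: ltnW. Qed.

Lemma base_pts : x0 \in pts n k. Proof. by rewrite inE -x0k. Qed.

Lemma base_fixed : a x0 = x0.
Proof. by have /in_Gsym-> := a_in; rewrite // -x0k. Qed.

Lemma involutive_perm : involutive a.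
Proof. by move=> x; rewrite -permM a2 perm1. Qed.

(** Numbering the points of the cycle by the integers modulo k, with 0 at x0,
    the involution is i |-> -i. *)
Lemma inverted_pow u i : u \in inverted_cycles -> i <= k ->
  a ((u ^+ i) x0) = (u ^+ (k - i)) x0.
Proof.
rewrite inE => /andP[kcyc /eqP ua] le_ik.
have -> : u ^+ (k - i) = (u ^+ i) ^ a.
  rewrite conjXg ua; apply: (mulIg (u ^+ i)); rewrite -expgD subnK //.
  by rewrite (expg_kcycle le_kn kcyc) expgVn mulVg.
by rewrite conjgE !permM -{2}base_fixed permK.
Qed.

(** In the numbering modulo k, the product is i |-> -1 - i, which fixes i only
    when 2i + 1 = k: one fixed point for odd k and none for even k. *)
Lemma card_support_mul u : u \in inverted_cycles ->
  #|[set x | (u * a) x != x]| = (k./2).*2.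
Proof.
move=> Xu; have kcyc : is_kcycle k u by move: Xu; rewrite inE => /andP[].
have Su : u \in Gsym n k by case/andP: kcyc.
have ua_fix i : i < k -> ((u * a) ((u ^+ i) x0) == (u ^+ i) x0) = (i.*2.+1 == k).
  move=> lt_ik; rewrite permM -(permM (u ^+ i) u) -expgSr (inverted_pow Xu) //.
  rewrite (expg_kcycle_eq k_gt0 le_kn kcyc _ _ base_pts) !modn_small //; lia.
have supp_in x : (u * a) x != x -> x \in pts n k.
  apply: contraR; rewrite inE -leqNgt => le_kx; rewrite permM.
  have /in_Gsym-> := Su; rewrite //; have /in_Gsym-> := a_in; rewrite //.
  by apply: leq_trans le_kx; apply: leq_pred.
have [odd_k | even_k] := boolP (odd k).
  have lt_k2 : k./2 < k by lia.
  have -> : [set x | (u * a) x != x] = pts n k :\ (u ^+ k./2) x0.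
    apply/setP=> x; rewrite in_setD1 inE; apply/idP/andP=> [ua_x | [neq_x x_k]].
      split; last exact: supp_in.
      by apply: contraNneq ua_x => ->; rewrite ua_fix //; lia.
    have [i lt_ik x_i] := expg_kcycle_onto le_kn kcyc base_pts x_k.
    rewrite x_i ua_fix //; apply: contraNneq neq_x => ik.
    by rewrite x_i (_ : i = k./2) //; lia.
  have := cardsD1 ((u ^+ k./2) x0) (pts n k); rewrite card_pts //.
  have -> : (u ^+ k./2) x0 \in pts n k.
    by rewrite -(porbit_kcycle kcyc base_pts) mem_porbit.
  by lia.
have -> : [set x | (u * a) x != x] = pts n k.
  apply/setP=> x; rewrite inE; apply/idP/idP=> [|x_k]; first exact: supp_in.
  have [i lt_ik ->] := expg_kcycle_onto le_kn kcyc base_pts x_k.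
  by rewrite ua_fix //; lia.
by rewrite card_pts //; lia.
Qed.

Let m := k.-1./2.
Hypothesis supp_a : #|[set x | a x != x]| = m.*2.

Let mid := [seq x <- enum (pts n k) | (a x == x) && (x != x0)].

(** The vertices of a k-gon read from x0, a being its reflection across the axis
    through x0, with s on one side of the axis and [mid] on it. *)
Definition symmetric_list (s : seq 'I_n) := x0 :: s ++ mid ++ rev (map a s).

(** Besides x0 and the 2m points moved by a, there is one more point if k is
    even, and none if k is odd. *)
Lemma size_mid : size mid = k - m.*2.+1.
Proof.
have -> : size mid = #|[set x in pts n k | (a x == x) && (x != x0)]|.
  rewrite cardE /mid /enum_mem -filter_predI; congr (size _).
  by apply: eq_filter => x; rewrite !inE /= andbC.
have x0k' := base_pts; have a0 := base_fixed.
have card_D1 := cardsD1 x0 (pts n k); rewrite card_pts // x0k' in card_D1.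
have := cardsID [set x | a x != x] (pts n k :\ x0).
have -> : (pts n k :\ x0) :&: [set x | a x != x] = [set x | a x != x].
  apply/setIidPr/subsetP=> x; rewrite !inE => ax.
  have -> /= : x != x0 by apply: contraNneq ax => ->; rewrite a0.
  apply: contraR ax; rewrite -leqNgt => le_kx; have /in_Gsym-> := a_in; rewrite //.
  by apply: leq_trans le_kx; apply: leq_pred.
have -> : (pts n k :\ x0) :\: [set x | a x != x]
            = [set x in pts n k | (a x == x) && (x != x0)].
  apply/setP=> x; rewrite !inE negbK.
  by case: (a x == x); case: (x == x0); rewrite ?andbF ?andbT.
by rewrite supp_a => eD; rewrite -eD in card_D1; move: #|_| card_D1 => q; lia.
Qed.

Lemma size_mid_le1 : size mid <= 1.
Proof. by rewrite size_mid /m; lia. Qed.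

Lemma mem_mid x : (x \in mid) = [&& x \in pts n k, a x == x & x != x0].
Proof. by rewrite mem_filter mem_enum andbC. Qed.

(** The orbit of x0 under an inverted cycle is determined by its first half:
    position -i is the image under a of position i, and for even k the
    position k/2 is the point opposite x0, which a fixes. *)
Lemma traject_inverted u : u \in inverted_cycles ->
  traject u x0 k = symmetric_list (traject u (u x0) m).
Proof.
move=> Xu; have kcyc : is_kcycle k u by move: Xu; rewrite inE => /andP[].
have k_eq : k = (m + (size mid + m)).+1 by rewrite size_mid /m; lia.
have a_pow := inverted_pow Xu.
have nth_tr i j l : l < j -> nth x0 (traject u (iter i u (u x0)) j) l = (u ^+ (i + l).+1) x0.
  move=> lt_lj; rewrite (set_nth_default (iter i u (u x0))) ?size_traject //.
  by rewrite nth_traject // -iterD -iterSr -permX addnC.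
rewrite {1}k_eq [LHS]/= trajectD trajectD -iterD.
rewrite /symmetric_list; congr (_ :: (_ ++ (_ ++ _))).
  case: mid size_mid_le1 (mem_mid) k_eq => [|y [|z s]] //= _ mem_y k_eq.
  have: iter m u (u x0) \in [:: y].
    rewrite mem_y -iterSr -permX a_pow; last by lia.
    rewrite -(porbit_kcycle kcyc base_pts) mem_porbit /=.
    rewrite -{4}[x0]perm1 -(expg0 u) !(expg_kcycle_eq k_gt0 le_kn kcyc) ?base_pts //.
    by rewrite !modn_small; lia.
  by rewrite inE => /eqP->.
apply: (@eq_from_nth _ x0); rewrite ?size_rev ?size_map ?size_traject // => l lt_l.
rewrite nth_tr // nth_rev ?size_map ?size_traject // (nth_map x0) ?size_traject; last by lia.
rewrite (nth_tr 0); last by lia.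
have idx q p : k = (p + (q + p)).+1 -> l < p ->
    (0 + (p - l.+1)).+1 <= k /\ k - (0 + (p - l.+1)).+1 = (q + p + l).+1 by lia.
by have [le_k eq_k] := idx _ _ k_eq lt_l; rewrite a_pow // eq_k.
Qed.

Lemma symmetric_list_map s : map a (symmetric_list s) = rotr 1 (rev (symmetric_list s)).
Proof.
rewrite /symmetric_list rev_cons rotr1_rcons /= base_fixed; congr (_ :: _).
rewrite !rev_cat !map_cat revK map_rev -!map_comp catA; congr (_ ++ _); last first.
  by rewrite map_id_in // => x _ /=; rewrite involutive_perm.
congr (_ ++ _).
have -> : rev mid = mid by case: mid size_mid_le1 => [|y [|]].
by rewrite map_id_in // => x; rewrite mem_mid => /and3P[_ /eqP].
Qed.

(** Conjugation by an involution that reverses a cyclic list exchanges the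
    successor and the predecessor. *)
Lemma next_conj c : uniq c -> map a c = rotr 1 (rev c) ->
  forall x, a (next c (a x)) = prev c x.
Proof.
move=> Uc sym x; rewrite -(next_map (@perm_inj _ a)) // sym involutive_perm.
by rewrite next_rotr ?rev_uniq // next_rev.
Qed.

Lemma symmetric_list_pts (s : m.-tuple 'I_n) :
    all [in [set x | a x != x]] s -> uniq (s ++ map a s) ->
  [/\ uniq (symmetric_list s), size (symmetric_list s) = k
     & symmetric_list s =i pts n k].
Proof.
move=> supp_s Us; have supp_as : all [in [set x | a x != x]] (map a s).
  rewrite all_map; apply: sub_all supp_s => x /=; rewrite !inE.
  by rewrite (inj_eq perm_inj).
have sz : size (symmetric_list s) = k.
  by rewrite /= !size_cat size_rev size_map size_tuple size_mid /m; lia.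
have supp_pts x : a x != x -> x \in pts n k.
  apply: contraR; rewrite inE -leqNgt => le_kx; have /in_Gsym-> := a_in; rewrite //.
  by apply: leq_trans le_kx; apply: leq_pred.
have U : uniq (symmetric_list s).
  have -> : uniq (symmetric_list s) = uniq (x0 :: mid ++ (s ++ map a s)).
    apply: perm_uniq; rewrite /symmetric_list perm_cons perm_catCA perm_cat2l.
    by rewrite perm_cat2l perm_rev.
  have supp_all : all [in [set x | a x != x]] (s ++ map a s) by rewrite all_cat supp_s.
  rewrite cons_uniq mem_cat cat_uniq Us mem_mid eqxx !andbF /= andbT.
  apply/and3P; split.
  - by apply/negP=> /(allP supp_all); rewrite inE base_fixed eqxx.
  - by rewrite filter_uniq ?enum_uniq.
  apply/hasPn=> x /(allP supp_all); rewrite inE mem_mid => /negPf->.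
  by rewrite andbF.
split=> //; apply/subset_cardP; first by rewrite (card_uniqP U) sz card_pts.
apply/subsetP=> x; rewrite inE => /predU1P[-> | ]; first exact: base_pts.
rewrite !mem_cat mem_rev mem_mid => /or3P[s_x | /and3P[]// | as_x]; apply: supp_pts.
  by have := allP supp_s x s_x; rewrite inE.
by have := allP supp_as x as_x; rewrite inE.
Qed.

Let radius (u : 'S_n) : m.-tuple 'I_n := Tuple (introT eqP (size_traject u (u x0) m)).

(** So the first half of the orbit of x0 determines an inverted cycle. *)
Lemma inverted_next u x : u \in inverted_cycles ->
  u x = next (symmetric_list (radius u)) x.
Proof.
move=> Xu; rewrite -(traject_inverted Xu).
have kcyc : is_kcycle k u by move: Xu; rewrite inE => /andP[].
have [_ tr_pts] := trajectP_kcycle le_kn kcyc base_pts.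
have cyc_tr : fcycle u (traject u x0 k).
  rewrite -(prednK k_gt0) /=; apply/fpathP; exists k.
  rewrite -[in RHS](prednK k_gt0) trajectSr; congr (rcons _ _).
  by rewrite -iterSr prednK // -permX (expg_kcycle le_kn kcyc) perm1.
have [x_k | nx_k] := boolP (x \in pts n k); first by rewrite (nextE cyc_tr) ?tr_pts.
rewrite next_nth tr_pts (negPf nx_k).
by case/andP: kcyc => /in_Gsym-> //; rewrite leqNgt; rewrite inE in nx_k.
Qed.

(** Conversely, the cyclic successor along a symmetric list is a full cycle, and
    a inverts it because the list is symmetric. *)
Lemma symmetric_list_cycle (s : m.-tuple 'I_n) :
    all [in [set x | a x != x]] s -> uniq (s ++ map a s) ->
  exists2 u, u \in inverted_cycles & radius u = s.
Proof.
move=> supp_s Us; have [U sz c_pts] := symmetric_list_pts supp_s Us.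
have sym := symmetric_list_map s; set c := symmetric_list s in U sz c_pts sym.
pose u : 'S_n := perm (can_inj (prev_next U)).
have uE x : u x = next c x by rewrite permE.
have tr_c : traject u x0 k = c.
  have : fcycle u c by rewrite -(eq_cycle (e := frel (next c))) ?cycle_next // => x y /=; rewrite uE.
  rewrite {1}/c /symmetric_list /= => /fpathE; rewrite -/c size_rcons.
  have -> : (size (s ++ mid ++ rev (map a s))).+1 = k by rewrite -sz.
  move=> e; have := congr1 (fun l => x0 :: l) e; rewrite -trajectS trajectSr -rcons_cons.
  by case/rcons_inj=> <-.
have in_u : u \in Gsym n k.
  apply/in_Gsym=> x le_kx; rewrite uE next_nth c_pts inE ltnNge le_kx //.
exists u; last first.
  apply: val_inj => /=; move: tr_c; rewrite -(prednK k_gt0) /= => -[].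
  move/(congr1 (take m)); rewrite take_traject; last by rewrite /m; lia.
  by rewrite take_size_cat ?size_tuple.
rewrite inE; apply/andP; split.
  rewrite /is_kcycle in_u; apply/imsetP; exists x0 => //; apply/setP=> y.
  apply/idP/porbitP=> [|[i ->]].
    by rewrite -c_pts -tr_c => /trajectP[i _ ->]; exists i; rewrite permX.
  rewrite permX; elim: i => [|i IHi] /=; first exact: base_pts.
  by rewrite uE -c_pts mem_next c_pts.
rewrite eq_sym eq_invg_mul; apply/eqP/permP=> x; rewrite conjgE !permM perm1.
have aV : a^-1 = a by apply/eqP; rewrite eq_invg_mul a2.
by rewrite aV !uE next_conj // prev_next.
Qed.

Lemma card_inverted_cycles : #|inverted_cycles| = (2 ^ m * m`!)%N.
Proof.
rewrite -(card_pair_transversals involutive_perm (A := [set x | a x != x])) //; last first.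
  by move=> x; rewrite !inE (inj_eq perm_inj) => ->.
have inj_r : {in inverted_cycles &, injective radius}.
  move=> u v Xu Xv eq_r; apply/permP=> x.
  by rewrite (inverted_next _ Xu) eq_r -inverted_next.
rewrite -(card_in_imset inj_r); apply: eq_card => s; rewrite [in RHS]inE.
apply/imsetP/andP=> [[u Xu ->] | [supp_s Us]]; last first.
  by have [u Xu <-] := symmetric_list_cycle supp_s Us; exists u.
have kcyc : is_kcycle k u by move: Xu; rewrite inE => /andP[].
have [U _] := trajectP_kcycle le_kn kcyc base_pts.
have Us : uniq (radius u ++ map a (radius u)).
  suffices: uniq (radius u ++ rev (map a (radius u))).
    by rewrite !cat_uniq has_rev rev_uniq.
  move: U; rewrite (traject_inverted Xu); apply: subseq_uniq.
  apply: subseq_trans (subseq_cons _ _).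
  by apply: cat_subseq; [exact: subseq_refl | exact: suffix_subseq].
split=> //; apply/allP=> x r_x; change (is_true (x \in [set x | a x != x])).
rewrite inE; apply: contraTneq Us => ax; rewrite cat_uniq.
have -> : has [in radius u] (map a (radius u)) by apply/hasP; exists x; rewrite // -ax map_f.
by rewrite andbF.
Qed.

End InvertedCycles.

(** * Counting towers of involutions *)

Section Counting.

Variable n : nat.

Definition extends k (a g : 'S_n) :=
  [&& g \in Gsym n k :\: Gsym n k.-1, is_kcycle k (g * a^-1) & #[g] == 2].

(** The size of the support is the one for which a, up to the names of the points,
    is a reflection of the (k+1)-gon on the first k+1 points that fixes the last
    of them; this is what the number of ways to continue depends on. *)
Definition reflection_like k (a : 'S_n) :=
  [/\ a \in Gsym n k, a * a = 1 & #|[set x | a x != x]| = (k./2).*2].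

(** For an involution a, the square of u * a is u * u ^ a, so u * a is an
    involution exactly when a inverts u; and u * a moves the last of the first
    k points since u does, so it lies outside G_(k-1). *)
Lemma extends_inverted k a : 1 < k -> k <= n -> reflection_like k.-1 a ->
  [set g | extends k a g] = [set u * a | u in inverted_cycles k a].
Proof.
move=> k_gt1 le_kn [a_in a2 _].
have k_gt0 := ltnW k_gt1; have le_k1n : k.-1 < n by rewrite prednK.
pose x0 := Ordinal le_k1n; have x0k : x0.+1 = k by rewrite /= prednK.
have ax0 := base_fixed x0k a_in.
have aV : a^-1 = a by apply/eqP; rewrite eq_invg_mul a2.
have a_k : a \in Gsym n k by apply: (subsetP (GsymS n (leq_pred k))).
have inv_iff u : (u ^ a == u^-1) = ((u * a) ^+ 2 == 1).
  have -> : (u * a) ^+ 2 = u * u ^ a by rewrite expgS expg1 conjgE aV !mulgA.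
  by rewrite -eq_invg_mul eq_sym.
apply/setP=> g; rewrite inE; apply/idP/imsetP=> [/and3P[_ kcyc /eqP g2] | [u]].
  exists (g * a^-1); last by rewrite mulgKV.
  by rewrite inE kcyc inv_iff mulgKV -order_dvdn g2.
rewrite inE inv_iff => /andP[kcyc ua2] ->; have u_in : u \in Gsym n k by case/andP: kcyc.
have nua : u * a \notin Gsym n k.-1.
  apply/negP=> /in_Gsym/(_ x0 (leqnn _)); rewrite permM -{2}ax0 => /perm_inj ux0.
  have := expg_kcycle_eq k_gt0 le_kn kcyc 1 0 (base_pts x0k).
  by rewrite expg1 expg0 perm1 ux0 eqxx mod0n modn_small.
rewrite /extends mulgK kcyc inE nua groupM //=.
rewrite (nt_prime_order (p := 2)) //; first exact/eqP.
by apply: contraNneq nua => ->; rewrite group1.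
Qed.

Lemma card_extends k a : 1 < k -> k <= n -> reflection_like k.-1 a ->
  #|[set g | extends k a g]| = (2 ^ ((k - 1) %/ 2) * ((k - 1) %/ 2)`!)%N.
Proof.
move=> k_gt1 le_kn refl_a; rewrite extends_inverted // card_imset; last exact: mulIg.
case: refl_a => a_in a2 supp_a; have le_k1n : k.-1 < n by rewrite prednK // ltnW.
rewrite (@card_inverted_cycles n k (Ordinal le_k1n) a) //= ?prednK ?(ltnW k_gt1) //.
by rewrite divn2 subn1.
Qed.

Lemma extends_reflection_like k a g : 1 < k -> k <= n ->
  reflection_like k.-1 a -> extends k a g -> reflection_like k g.
Proof.
move=> k_gt1 le_kn refl_a ext_g; have le_k1n : k.-1 < n by rewrite prednK // ltnW.
split; first by case/and3P: ext_g => /setDP[].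
  by case/and3P: ext_g => _ _ /eqP g2; have := expg_order g; rewrite g2 expgS expg1.
have: g \in [set g | extends k a g] by rewrite inE.
rewrite extends_inverted // => /imsetP[u Xu ->]; case: refl_a => a_in a2 _.
by apply: (@card_support_mul n k (Ordinal le_k1n)); rewrite /= ?prednK // ltnW.
Qed.

(** The conditions on g_k, g_(k+1), ... once g_(k-1) = a is known; peeling off the
    first entry makes the count a product. *)
Fixpoint tower_from k (a : 'S_n) (s : seq 'S_n) : bool :=
  if s is g :: s' then extends k a g && tower_from k.+1 g s' else true.

Lemma tower_fromP k a s :
  reflect (forall i, i < size s ->
             extends (i + k) (nth 1 (a :: s) i) (nth 1 s i))
          (tower_from k a s).
Proof.
elim: s k a => [|g s IHs] k a /=; first by apply: ReflectT.
apply: (iffP andP) => [[ext_g /IHs ext_s] [|i] //= lt_i | ext].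
  by rewrite addSnnS; apply: ext_s.
split; first exact: (ext 0).
by apply/IHs=> i lt_i; rewrite -addSnnS; apply: (ext i.+1).
Qed.

Lemma card_tower_from j k a : 1 < k -> k + j <= n.+1 -> reflection_like k.-1 a ->
  #|[set s : j.-tuple 'S_n | tower_from k a s]|
    = (\prod_(k <= i < k + j) (2 ^ ((i - 1) %/ 2) * ((i - 1) %/ 2)`!))%N.
Proof.
elim: j k a => [|j IHj] k a k_gt1 le_kn refl_a.
  rewrite addn0 big_geq // (@eq_card1 _ [tuple]) // => s.
  by rewrite [s]tuple0 !inE.
have le_k : k <= n by lia.
rewrite card_tuple_cons (bigID (extends k a)) /= [X in (_ + X)%N]big1 ?addn0; last first.
  by move=> g /negPf next_g; apply: eq_card0 => s; rewrite inE next_g.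
set prd := (\prod_(k <= i < _) _)%N.
rewrite (eq_bigr (fun=> \prod_(k.+1 <= i < k.+1 + j) (2 ^ ((i - 1) %/ 2) * ((i - 1) %/ 2)`!))%N).
  rewrite sum_nat_cond_const /prd [RHS]big_ltn; last by lia.
  by rewrite -addSnnS -(card_extends k_gt1 le_k refl_a).
move=> g ext_g; have refl_g := extends_reflection_like k_gt1 le_k refl_a ext_g.
rewrite -(IHj k.+1 g (leqW k_gt1) _ refl_g); last by lia.
by apply: eq_card => s; rewrite !inE ext_g.
Qed.

Lemma tower_involutions_from (t : n.-1.-tuple 'S_n) : 0 < n ->
  tower t && all_involutions t = tower_from 2 1 t.
Proof.
move=> n_gt0; apply/andP/tower_fromP => [[/forallP tow /allP inv] i | ext].
  rewrite size_tuple => lt_i; have lt_i2 : i.+2 < n.+1 by lia.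
  have := tow (Ordinal lt_i2); rewrite /= addn2 => /andP[i1 i2].
  by rewrite /extends i1 i2 inv // mem_nth // size_tuple.
split.
  apply/forallP=> -[[|[|k]] lt_k] //=; have lt_k1 : k < size t by rewrite size_tuple; lia.
  by have := ext k lt_k1; rewrite addn2 => /and3P[-> ->].
apply/allP=> g /(nthP 1)[i lt_i <-].
by case/and3P: (ext i lt_i).
Qed.

Lemma card_involution_towers : 0 < n ->
  #|[set t : n.-1.-tuple 'S_n | tower t && all_involutions t]| =
    (\prod_(2 <= k < n.+1) (2 ^ ((k - 1) %/ 2) * ((k - 1) %/ 2)`!))%N.
Proof.
move=> n_gt0; have -> : n.+1 = 2 + n.-1 by lia.
rewrite -(@card_tower_from _ _ 1) //; last 2 first.
- by lia.
- split; rewrite ?group1 ?mulg1 //.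
  by apply: eq_card0 => x; rewrite inE perm1 eqxx.
by apply: eq_card => t; rewrite !inE tower_involutions_from.
Qed.

End Counting.

Lemma sum_half_pred n : 0 < n ->
  (\sum_(2 <= k < n.+1) (k - 1) %/ 2 = (n - 1) ^ 2 %/ 4)%N.
Proof.
elim: n => // -[|n] IHn _; first by rewrite big_geq.
rewrite big_nat_recr //= IHn //.
have [q [b [-> lt_b]]] : exists q b, n = (q * 2 + b)%N /\ b < 2.
  by exists (n %/ 2), (n %% 2); rewrite -divn_eq ltn_mod.
nia.
Qed.

Lemma prod_pow_half n : 0 < n ->
  (\prod_(2 <= k < n.+1) (2 ^ ((k - 1) %/ 2) * ((k - 1) %/ 2)`!))%N =
    (2 ^ ((n - 1) ^ 2 %/ 4) * \prod_(2 <= k < n.+1) ((k - 1) %/ 2)`!)%N.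
Proof. by move=> n_gt0; rewrite big_split /= -expn_sum sum_half_pred. Qed.

Theorem theorem5p5 (n : nat) (hn : 3 <= n) :
  (forall t : n.-1.-tuple 'S_n, tower t ->
     (all_involutions t ->
        dihedral_cycle (alphabet t) (tower_cycle t) /\
        Stab (tower_cycle t) =
          <<[set ltrans (step t n); ltrans (gen t n)]>> :> {set {perm 'S_n}}) /\
     (~~ all_involutions t ->
        cyclic_cycle (alphabet t) (tower_cycle t) /\
        Stab (tower_cycle t) = <[ltrans (step t n)]> :> {set {perm 'S_n}})) /\
  #|[set t : n.-1.-tuple 'S_n | tower t && all_involutions t]| =
    (\prod_(2 <= k < n.+1) (2 ^ ((k - 1) %/ 2) * ((k - 1) %/ 2)`!))%N /\
  (\prod_(2 <= k < n.+1) (2 ^ ((k - 1) %/ 2) * ((k - 1) %/ 2)`!))%N =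
    (2 ^ ((n - 1) ^ 2 %/ 4) * \prod_(2 <= k < n.+1) ((k - 1) %/ 2)`!)%N.
Proof.
have n_gt0 : 0 < n by lia.
have n_gt1 : 1 < n by lia.
split; last by split; [exact: card_involution_towers | exact: prod_pow_half].
move=> t towt; split=> inv.
  exact: tower_dihedral towt n_gt0 n_gt1 hn inv.
exact: tower_cyclic towt n_gt0 n_gt1 hn inv.
Qed.
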